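(* Let $c>0$, $\pi>0$, $\alpha\in[0,1]$, and let $F$ be a CDF on $[0,1]$ with a density $f$ that is strictly positive on $(0,1)$ and such that the inverse hazard rate $\frac{1-F(v)}{f(v)}$ is decreasing in $v$ for all $v\in(0,1)$. Assume $\rho>1$. Consider the problem of choosing functions $X:[0,1]\to[0,1]$, $W:[0,1]\to[0,\infty)$, $p:[0,1]\to[0,\infty)$ to maximize $$\alpha\rho\int_0^1U(v)f(v)\,dv+(1-\alpha)\rho\int_0^1\pi X(v)f(v)\,dv,\qquad U(v):=vX(v)-cW(v),$$ subject to $$U(v)\ge 0\quad\forall v,\qquad U(v)\ge vX(v')-cW(v')\quad\forall v,v',$$ $$\rho\int_v^1 W(s)f(s)\,ds=p(v)\quad\forall v,\qquad \rho\int_0^1X(s)f(s)\,ds\le 1.$$ At the optimal mechanism $(X,W,p)$ solving this problem, all buyers are served with a lottery $X(\cdot)\equiv 1/\rho$ without any delays, i.e., $W(v)=p(v)\equiv 0$.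
   Context: Interpretation: in a fluid (continuum) queueing model, at every instant a unit mass of items and a mass $\rho$ of buyers arrive; buyers have private values $v$ distributed according to $F$ and incur waiting cost $c$ per unit time, and there are no monetary transfers. $X(v)$ is the eventual allocation probability and $W(v)$ the expected waiting time of a buyer who reports value $v$; $U(v)$ is his equilibrium payoff; $p(v)$ is the steady-state mass of buyers in the queue with values above $v$; $\pi$ is the firm's profit generated whenever a buyer is served; $\alpha$ and $1-\alpha$ are the designer's weights on buyer welfare and firm profit. The constraints are, in order, individual rationality, incentive compatibility, Little's law, and feasibility of the allocation given the available items. A mechanism means a triple $(X,W,p)$ of (measurable) functions satisfying these constraints.
   Formalization: The lottery is proved optimal for all α in [0,1]; that every optimal mechanism equals it is claimed only for α>0, with X=1/ρ on (0,1), W=0 on [0,1), p=0 on [0,1], since uniqueness fails for α=0 and the values X(0), X(1), W(1) are not determined. *)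

(* Defs.v *)
From HB Require Import structures.
From mathcomp Require Import all_boot all_order all_algebra.
From mathcomp Require Import all_classical all_reals all_analysis.

Set Implicit Arguments.
Unset Strict Implicit.
Unset Printing Implicit Defensive.

Import Order.TTheory GRing.Theory Num.Theory.
Import numFieldNormedType.Exports.

Local Open Scope classical_set_scope.
Local Open Scope ring_scope.

(* Functions on [0, 1] are represented by total functions R -> R, only the
   values of which on `[0, 1] are ever constrained or used. *)

(* Being a CDF with F 1 = 1 and (by the last field at v = 0) F 0 = 0, F is the
   CDF of a distribution carried by [0, 1]. *)
Record has_density01 (R : realType) (F : cumulativeBounded (0 : R) (1 : R))
    (f : R -> R) : Prop := {
  density_measurable : measurable_fun `[(0 : R), 1] f ;
  density_ge0 : {in `[0, 1], forall v, 0 <= f v} ;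
  density_cdf1 : F 1 = 1 ;
  density_cdf : {in `[0, 1], forall v,
    (F v)%:E = (\int[lebesgue_measure]_(s in `[0%R, v]) (f s)%:E)%E } }.

Definition inverse_hazard (R : realType) (F f : R -> R) (v : R) : R :=
  (1 - F v) / f v.

Definition payoff (R : realType) (c : R) (X W : R -> R) (v : R) : R :=
  v * X v - c * W v.

(* The integrals are extended-real valued: little_law forces the waiting time
   to be integrable against f. *)
Record mechanism (R : realType) (c rho : R) (f X W p : R -> R) : Prop := {
  alloc_measurable : measurable_fun `[(0 : R), 1] X ;
  wait_measurable : measurable_fun `[(0 : R), 1] W ;
  queue_measurable : measurable_fun `[(0 : R), 1] p ;
  alloc_prob : {in `[0, 1], forall v, 0 <= X v <= 1} ;
  wait_ge0 : {in `[0, 1], forall v, 0 <= W v} ;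
  queue_ge0 : {in `[0, 1], forall v, 0 <= p v} ;
  individual_rationality : {in `[0, 1], forall v, 0 <= payoff c X W v} ;
  incentive_compatibility : {in `[0, 1] &, forall v v',
    v * X v' - c * W v' <= payoff c X W v} ;
  little_law : {in `[0, 1], forall v,
    (rho%:E * \int[lebesgue_measure]_(s in `[v, 1%R]) (W s * f s)%:E
     = (p v)%:E)%E } ;
  feasibility :
    (rho%:E * \int[lebesgue_measure]_(s in `[0%R, 1%R]) (X s * f s)%:E
     <= 1)%E }.

(* Finite for every mechanism, since then 0 <= payoff c X W v <= 1 and
   0 <= X v <= 1 on [0, 1]. *)
Definition objective (R : realType) (c profit alpha rho : R)
    (f X W : R -> R) : \bar R :=
  ((alpha * rho)%:E *
     \int[lebesgue_measure]_(v in `[0%R, 1%R]) (payoff c X W v * f v)%:E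
   + ((1 - alpha) * rho)%:E *
     \int[lebesgue_measure]_(v in `[0%R, 1%R]) (profit * X v * f v)%:E)%E.

Definition optimal_mechanism (R : realType) (c profit alpha rho : R)
    (f X W p : R -> R) : Prop :=
  mechanism c rho f X W p /\
  forall X' W' p' : R -> R, mechanism c rho f X' W' p' ->
    (objective c profit alpha rho f X' W'
     <= objective c profit alpha rho f X W)%E.

(* Main.v *)
Require Import Defs.
From HB Require Import structures.
From mathcomp Require Import all_boot all_order all_algebra.
From mathcomp Require Import all_classical all_reals all_analysis.
From mathcomp Require Import measurable_realfun ring lra.
Import Order.TTheory GRing.Theory Num.Theory.
Import numFieldNormedType.Exports.
Local Open Scope classical_set_scope.
Local Open Scope ring_scope.

Set Implicit Arguments.
Unset Strict Implicit.
Unset Printing Implicit Defensive.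

(* Incentive compatibility makes X a nondecreasing subgradient of the payoff U,
   and U 0 = 0 since a buyer of value 0 can only lose by waiting.  The envelope
   formula then turns the welfare into the integral of X (1 - F).  Writing m for
   the mean of F and h for the inverse hazard rate, this is the integral of
   X h f, where X is nondecreasing, h is nonincreasing and h has mean m under f;
   Chebyshev's inequality bounds it by m times the integral of X f, hence by
   m / rho.  The lottery 1 / rho attains this bound and the feasibility bound on
   the profit simultaneously.  In the equality case X is constant, because h
   exceeds m near 0 and is below m near 1 (h cannot stay above m near 1, as F
   reaches 1 there), and constancy of X together with U >= 0 forces W = 0. *)

(** * Integrals over compact intervals *)

Section interval_integrals.
Context {R : realType}.
Local Notation mu := (@lebesgue_measure R).

(** On a subdivision of [[a, b]] into pieces of equal length, the bounds telescope to that length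
    times [g b - g a], which vanishes as the mesh shrinks. *)
Lemma telescoping_constant (Phi g : R -> R) (a b : R) : a <= b ->
  {in `[a, b] &, forall v w, v <= w ->
    `|Phi w - Phi v| <= (w - v) * (g w - g v)} ->
  Phi b = Phi a.
Proof.
move=> ab Phi_g; apply/eqP; rewrite -subr_eq0 -normr_eq0 eq_le normr_ge0 andbT.
set C := (b - a) * (g b - g a).
have bound n : `|Phi b - Phi a| * n.+1%:R <= C.
  pose h := (b - a) / n.+1%:R; pose x i := a + i%:R * h.
  have n_gt0 : 0 < n.+1%:R :> R by rewrite ltr0n.
  have h_ge0 : 0 <= h by rewrite divr_ge0 ?subr_ge0// ltW.
  have xn : x n.+1 = b by rewrite /x /h mulrCA divff ?gt_eqF// mulr1 subrKC.
  have x_le i j : (i <= j)%N -> x i <= x j.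
    by move=> ij; rewrite lerD2l ler_wpM2r// ler_nat.
  have x_in i : (i <= n.+1)%N -> x i \in `[a, b].
    move=> i_n; rewrite in_itv/= -xn x_le// andbT.
    by rewrite lerDl mulr_ge0// ler0n.
  have step i : (i <= n.+1)%N ->
      `|Phi (x i) - Phi a| <= h * (g (x i) - g a).
    elim: i => [_|i IH i_n].
      by rewrite /x mul0r addr0 !subrr normr0 mulr0.
    have := Phi_g _ _ (x_in _ (ltnW i_n)) (x_in _ i_n) (x_le _ _ (leqnSn i)).
    have -> : x i.+1 - x i = h by rewrite /x -natr1; ring.
    move=> le_h; have le_i := IH (ltnW i_n).
    have := ler_normD (Phi (x i.+1) - Phi (x i)) (Phi (x i) - Phi a).
    rewrite addrA subrK; lra.
  have := step _ (leqnn _); rewrite xn -(ler_pM2r n_gt0).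
  by rewrite [h * _ * _]mulrAC divfK ?gt_eqF.
(* A nonzero difference would contradict [bound] at any index beyond [C] divided by it. *)
rewrite leNgt; apply/negP => d_gt0.
have := bound (Num.trunc (C / `|Phi b - Phi a|)).
by rewrite leNgt -ltr_pdivrMl// mulrC truncnS_gt.
Qed.

Lemma integrable_itvS (a b c d : R) (g : R -> R) :
  a <= c -> d <= b ->
  mu.-integrable `[a, b] (EFin \o g) -> mu.-integrable `[c, d] (EFin \o g).
Proof.
move=> ac db; apply: integrableS => // x /=.
by rewrite !in_itv/= => /andP[/(le_trans ac)-> /le_trans->].
Qed.

Lemma Rintegral_itv_cat (a x b : R) (g : R -> R) :
  a <= x <= b -> mu.-integrable `[a, b] (EFin \o g) ->
  \int[mu]_(t in `[a, b]) g t =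
  \int[mu]_(t in `[a, x]) g t + \int[mu]_(t in `[x, b]) g t.
Proof.
move=> /andP[ax xb] ig.
rewrite -(@Rintegral_itv_obnd_cbnd _ x); last first.
  apply: integrableS ig => // t /=; rewrite !in_itv/= => /andP[/ltW xt ->].
  by rewrite (le_trans ax xt).
by rewrite -(@Rintegral_itvB _ g (BLeft a) (BRight b)) ?bnd_simp// subrKC.
Qed.

Lemma Rintegral_itv_le (a b : R) (g h : R -> R) :
  mu.-integrable `[a, b] (EFin \o g) ->
  mu.-integrable `[a, b] (EFin \o h) ->
  {in `[a, b], forall x, g x <= h x} ->
  \int[mu]_(t in `[a, b]) g t <= \int[mu]_(t in `[a, b]) h t.
Proof. by move=> ig ih gh; exact: le_Rintegral. Qed.

Lemma Rintegral_itv_cst (a b k : R) : a <= b ->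
  \int[mu]_(t in `[a, b]) k = k * (b - a).
Proof.
rewrite le_eqVlt Rintegral_cst//= lebesgue_measure_itv/= lte_fin.
by case/predU1P => [->|->//]; rewrite ltxx subrr.
Qed.

Lemma integrable_itv_bounded (a b M : R) (g : R -> R) :
  measurable_fun `[a, b] g -> {in `[a, b], forall x, `|g x| <= M} ->
  mu.-integrable `[a, b] (EFin \o g).
Proof.
move=> mg gM; apply: measurable_bounded_integrable => //.
  by rewrite /= lebesgue_measure_itv/=; case: ifPn => // _; rewrite -EFinB ltry.
exists M; split; first exact: num_real.
by move=> x Mx t /= tab; rewrite (le_trans (gM _ tab))// ltW.
Qed.

Lemma integrable_itvM_bounded (a b M : R) (g h : R -> R) :
  measurable_fun `[a, b] g -> {in `[a, b], forall x, `|g x| <= M} ->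
  mu.-integrable `[a, b] (EFin \o h) ->
  mu.-integrable `[a, b] (EFin \o (fun x => g x * h x)).
Proof.
move=> mg gM ih.
have -> : EFin \o (fun x => g x * h x) = ((EFin \o g) \* (EFin \o h))%E by [].
apply: integrableMr => //.
exists M; split; first exact: num_real.
by move=> x Mx t /= tab; rewrite (le_trans (gM _ tab))// ltW.
Qed.

Lemma integrable_itvZ (a b k : R) (g : R -> R) :
  mu.-integrable `[a, b] (EFin \o g) ->
  mu.-integrable `[a, b] (EFin \o (fun x => k * g x)).
Proof. exact: (@integrable_itvM_bounded _ _ `|k| (fun=> k)). Qed.

Lemma integrable_itvB (a b : R) (g h : R -> R) :
  mu.-integrable `[a, b] (EFin \o g) -> mu.-integrable `[a, b] (EFin \o h) ->
  mu.-integrable `[a, b] (EFin \o (fun x => g x - h x)).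
Proof. by move=> ig ih; apply: (integrableB _ ig ih). Qed.

(** A zero integral would make [g] vanish almost everywhere on the open interval, enclosing an
    interval of length [b - a > 0] in a null set. *)
Lemma Rintegral_itv_gt0 (a b : R) (g : R -> R) : a < b ->
  mu.-integrable `[a, b] (EFin \o g) ->
  {in `]a, b[, forall x, 0 < g x} -> 0 < \int[mu]_(t in `[a, b]) g t.
Proof.
move=> ab ig g_gt0.
have ig' : mu.-integrable `]a, b[ (EFin \o g).
  by apply: integrableS ig => //; exact: subset_itv_oo_cc.
have ig'' : mu.-integrable `]a, b] (EFin \o g).
  by apply: integrableS ig => //; exact: subset_itv_oc_cc.
rewrite -Rintegral_itv_obnd_cbnd// -Rintegral_itv_bndo_bndc//.
rewrite lt_neqAle Rintegral_ge0 ?andbT; last first.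
  by move=> x /= xab; rewrite ltW// g_gt0.
apply/eqP => int0.
have mg := measurable_int _ ig'.
have abs0 : (\int[mu]_(x in `]a, b[) `|(EFin \o g) x| = 0)%E.
  transitivity (\int[mu]_(x in `]a, b[) (EFin \o g) x)%E.
    apply: eq_integral => x /set_mem/= xab.
    by rewrite ger0_norm// ltW// g_gt0.
  rewrite -(fineK (integrable_fin_num _ ig'))//.
  by rewrite -[fine _]/(\int[mu]_(x in `]a, b[) g x) -int0.
have [N [mN N0 sN]] := (ae_eq_integral_abs mu (measurable_itv _) mg).1 abs0.
have : (mu `]a, b[ <= 0)%E.
  rewrite -N0; apply: le_measure; rewrite ?inE//.
  apply: subset_trans sN => x /= xab /(_ xab) [gx0].
  by have := g_gt0 _ xab; rewrite gx0 ltxx.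
by rewrite /= lebesgue_measure_itv/= lte_fin ab -EFinB lee_fin subr_le0
  leNgt ab.
Qed.

Lemma Rintegral_itv_ge0 (a b : R) (g : R -> R) : a < b ->
  mu.-integrable `[a, b] (EFin \o g) ->
  {in `]a, b[, forall x, 0 <= g x} -> 0 <= \int[mu]_(t in `[a, b]) g t.
Proof.
move=> ab ig g_ge0.
rewrite -Rintegral_itv_obnd_cbnd; last first.
  by apply: integrableS ig => //; exact: subset_itv_oc_cc.
rewrite -Rintegral_itv_bndo_bndc; last first.
  by apply: integrableS ig => //; exact: subset_itv_oo_cc.
by apply: Rintegral_ge0 => x /= /g_ge0.
Qed.

Lemma eq_Rintegral_itv_oo (a b : R) (g h : R -> R) : a < b ->
  mu.-integrable `[a, b] (EFin \o g) -> mu.-integrable `[a, b] (EFin \o h) ->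
  {in `]a, b[, g =1 h} ->
  \int[mu]_(t in `[a, b]) g t = \int[mu]_(t in `[a, b]) h t.
Proof.
move=> ab ig ih gh; apply/eqP; rewrite eq_le -subr_ge0 -[X in _ && X]subr_ge0.
by rewrite -!RintegralB// !Rintegral_itv_ge0//;
  [exact: integrable_itvB|move=> x /gh ->; rewrite subrr|
   exact: integrable_itvB|move=> x /gh ->; rewrite subrr].
Qed.

(** This takes the place of almost-everywhere reasoning: zeros of [g] are found in any subinterval,
    in particular as close to an endpoint as desired, and monotonicity does the rest later. Without
    a zero in []c, d[], that piece alone would make the integral positive. *)
Lemma Rintegral_itv_eq0 (a b c d : R) (g : R -> R) :
  mu.-integrable `[a, b] (EFin \o g) ->
  {in `]a, b[, forall x, 0 <= g x} -> \int[mu]_(t in `[a, b]) g t = 0 ->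
  a <= c < d -> d <= b -> exists2 x, x \in `]c, d[ & g x = 0.
Proof.
move=> ig g_ge0 int0 /andP[ac cd] db; apply: contrapT => no_zero.
have : 0 < \int[mu]_(t in `[c, d]) g t.
  apply: Rintegral_itv_gt0 => //; first exact: integrable_itvS ig.
  move=> x; rewrite in_itv/= => /andP[cx xd].
  rewrite lt_neqAle g_ge0 ?in_itv/= ?(le_lt_trans ac cx) ?(lt_le_trans xd db)//.
  rewrite andbT eq_sym; apply/eqP => gx0; apply: no_zero; exists x => //.
  by rewrite in_itv/= cx.
rewrite ltNge => /negP; apply; rewrite -int0.
have nonneg u v : a <= u <= v -> v <= b -> 0 <= \int[mu]_(t in `[u, v]) g t.
  move=> /andP[au]; rewrite le_eqVlt => /predU1P[->|uv] vb.
    by rewrite set_itv1 Rintegral_set1.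
  apply: Rintegral_itv_ge0 => //; first exact: integrable_itvS ig.
  move=> x; rewrite in_itv/= => /andP[ux xv]; apply: g_ge0.
  by rewrite in_itv/= (le_lt_trans au ux) (lt_le_trans xv vb).
rewrite (@Rintegral_itv_cat a c b)//; last by rewrite ac (le_trans (ltW cd)).
rewrite (@Rintegral_itv_cat c d b) ?(ltW cd)//; last exact: integrable_itvS ig.
rewrite addrCA lerDl addr_ge0// nonneg// ?lexx// ?ac ?(le_trans (ltW cd) db)//.
by rewrite (le_trans ac (ltW cd)).
Qed.

End interval_integrals.

(** * Distributions with a density, and the envelope formula *)

Section distributions.
Context {R : realType} (F : cumulativeBounded (0 : R) (1 : R)) (f : R -> R).
Hypothesis F_density : has_density01 F f.
Local Notation mu := (@lebesgue_measure R).

Lemma density_integrable : mu.-integrable `[0, 1] (EFin \o f).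
Proof.
case: F_density => mf f_ge0 F1 cdf; apply/integrableP; split.
  exact/measurable_EFinP.
rewrite (_ : (\int[mu]_(x in `[0%R, 1%R]) `|(EFin \o f) x|)%E = (F 1)%:E).
  exact: ltry.
rewrite cdf ?in_itv/= ?lexx ?ler01//; apply: eq_integral => x /set_mem/= x01.
by rewrite ger0_norm// f_ge0.
Qed.

Lemma density_Rintegral (v w : R) : 0 <= v <= w -> w <= 1 ->
  \int[mu]_(s in `[v, w]) f s = F w - F v.
Proof.
move=> /andP[v0 vw] w1.
have cdf x : 0 <= x <= 1 -> F x = \int[mu]_(s in `[0, x]) f s.
  by move=> x01; rewrite /Rintegral -(density_cdf F_density) ?in_itv.
rewrite !cdf ?v0 ?(le_trans vw w1) ?(le_trans v0 vw)//.
rewrite (@Rintegral_itv_cat _ 0 v w) ?v0//; first by rewrite addrAC subrr add0r.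
exact: integrable_itvS density_integrable.
Qed.

Lemma survival_Rintegral (v : R) : 0 <= v <= 1 ->
  \int[mu]_(s in `[v, 1]) f s = 1 - F v.
Proof. by move=> v01; rewrite density_Rintegral// (density_cdf1 F_density). Qed.

Lemma cdf_homo (v w : R) : v <= w -> F v <= F w.
Proof. by move=> vw; apply: cumulative_is_nondecreasing. Qed.

Lemma cdf0 : F 0 = 0.
Proof.
have := density_cdf F_density (x := 0).
rewrite in_itv/= lexx ler01 => /(_ isT).
by rewrite set_itv1 integral_set1 => -[].
Qed.

Lemma survival_measurable (D : set R) : measurable D ->
  measurable_fun D (fun v => 1 - F v).
Proof.
by move=> mD; apply: nonincreasing_measurable => // v w vw;
  rewrite lerB// cdf_homo.
Qed.

Lemma survival_itv (v : R) : v \in `[0, 1] -> 0 <= 1 - F v <= 1.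
Proof.
rewrite in_itv/= => /andP[/cdf_homo + /cdf_homo].
by rewrite cdf0 (density_cdf1 F_density) subr_ge0 gerBl => -> ->.
Qed.

Lemma integrable_mul_survival (X : R -> R) : measurable_fun `[(0 : R), 1] X ->
  {in `[0, 1], forall v, 0 <= X v <= 1} ->
  mu.-integrable `[0, 1] (EFin \o (fun v => X v * (1 - F v))).
Proof.
move=> mX X01; apply: (@integrable_itv_bounded _ _ _ 1).
  by apply: measurable_funM => //; exact: survival_measurable.
move=> v v01; have /andP[X0 X1] := X01 _ v01.
have /andP[G0 G1] := survival_itv v01.
by rewrite ger0_norm ?mulr_ge0// mulr_ile1.
Qed.

Lemma integrable_mul_density (X : R -> R) : measurable_fun `[(0 : R), 1] X ->
  {in `[0, 1], forall v, 0 <= X v <= 1} ->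
  mu.-integrable `[0, 1] (EFin \o (fun v => X v * f v)).
Proof.
move=> mX X01; apply: (@integrable_itvM_bounded _ _ _ 1) => //.
  by move=> v /X01/andP[X0 X1]; rewrite ger0_norm.
exact: density_integrable.
Qed.

Lemma integral_envelope (X U : R -> R) :
  measurable_fun `[(0 : R), 1] X -> measurable_fun `[(0 : R), 1] U ->
  {in `[0, 1], forall v, 0 <= X v <= 1} ->
  {in `[0, 1], forall v, 0 <= U v <= 1} ->
  {in `[0, 1] &, forall v w, v <= w -> X v <= X w} ->
  {in `[0, 1] &, forall v w, v <= w ->
    (w - v) * X v <= U w - U v <= (w - v) * X w} ->
  U 0 = 0 ->
  \int[mu]_(v in `[0, 1]) (U v * f v) =
  \int[mu]_(v in `[0, 1]) (X v * (1 - F v)).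
Proof.
(* [Phi] moves by at most [w - v] times the increment of [X + F] over [v, w], so
   it is constant: this avoids both Fubini and the derivative of [U]. *)
move=> mX mU X01 U01 X_homo U_incr U0.
pose Phi v := \int[mu]_(s in `[0, v]) (U s * f s) + U v * (1 - F v)
  - \int[mu]_(s in `[0, v]) (X s * (1 - F s)).
have iU := integrable_mul_density mU U01.
have iX := integrable_mul_survival mX X01.
have : Phi 1 = Phi 0.
  apply: (@telescoping_constant _ Phi (fun v => X v + F v)) => //.
  move=> v w v01 w01 vw.
  have := v01; rewrite in_itv/= => /andP[v0 v1].
  have := w01; rewrite in_itv/= => /andP[w0 w1].
  have sub x : x \in `[v, w] -> x \in `[0, 1].
    by rewrite !in_itv/= => /andP[vx xw]; rewrite (le_trans v0 vx)
      (le_trans xw).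
  have v_in : v \in `[v, w] by rewrite in_itv/= lexx.
  have w_in : w \in `[v, w] by rewrite in_itv/= lexx andbT.
  have vw01 : 0 <= v <= w by rewrite v0.
  have iU' := @integrable_itvS _ _ _ _ _ _ v0 w1 iU.
  have iX' := @integrable_itvS _ _ _ _ _ _ v0 w1 iX.
  have if' := @integrable_itvS _ _ _ _ _ _ v0 w1 density_integrable.
  have ifZ k : mu.-integrable `[v, w] (EFin \o (fun s => k * f s)).
    exact: integrable_itvZ.
  have U_homo x y : x \in `[v, w] -> y \in `[v, w] -> x <= y -> U x <= U y.
    move=> /sub x01 /sub y01 xy; have /andP[+ _] := U_incr _ _ x01 y01 xy.
    rewrite -[_ <= U y]subr_ge0; apply: le_trans.
    by have /andP[? _] := X01 _ x01; rewrite mulr_ge0// subr_ge0.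
  have IUl : U v * (F w - F v) <= \int[mu]_(s in `[v, w]) (U s * f s).
    rewrite -density_Rintegral// -RintegralZl//.
    apply: Rintegral_itv_le => // x x_in.
    rewrite ler_wpM2r ?(density_ge0 F_density) ?sub//.
    by rewrite U_homo//; move: x_in; rewrite in_itv => /andP[].
  have IUr : \int[mu]_(s in `[v, w]) (U s * f s) <= U w * (F w - F v).
    rewrite -density_Rintegral// -RintegralZl//.
    apply: Rintegral_itv_le => // x x_in.
    rewrite ler_wpM2r ?(density_ge0 F_density) ?sub//.
    by rewrite U_homo//; move: x_in; rewrite in_itv => /andP[].
  have icst k : mu.-integrable `[v, w] (EFin \o (fun=> k : R)).
    exact: (@integrable_itv_bounded _ _ _ `|k|).
  have IXl : X v * (1 - F w) * (w - v) <=
      \int[mu]_(s in `[v, w]) (X s * (1 - F s)).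
    rewrite -Rintegral_itv_cst//; apply: Rintegral_itv_le => // x x_in.
    move: (x_in); rewrite in_itv => /andP[vx xw].
    have /andP[? _] := X01 _ v01; have /andP[? _] := survival_itv w01.
    by rewrite ler_pM// ?X_homo ?sub// lerB// cdf_homo.
  have IXr : \int[mu]_(s in `[v, w]) (X s * (1 - F s)) <=
      X w * (1 - F v) * (w - v).
    rewrite -Rintegral_itv_cst//; apply: Rintegral_itv_le => // x x_in.
    move: (x_in); rewrite in_itv => /andP[vx xw].
    have /andP[? _] := X01 _ (sub _ x_in).
    have /andP[? _] := survival_itv (sub _ x_in).
    by rewrite ler_pM// ?X_homo ?sub// lerB// cdf_homo.
  rewrite /Phi (@Rintegral_itv_cat _ 0 v w) ?vw01//; last first.
    exact: integrable_itvS iU.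
  rewrite (@Rintegral_itv_cat _ 0 v w _ vw01); last exact: integrable_itvS iX.
  have /andP[Ul Ur] := U_incr _ _ v01 w01 vw.
  have /andP[Gw0 Gw1] := survival_itv w01.
  have /andP[Gv0 Gv1] := survival_itv v01.
  have /andP[Xw0 Xw1] := X01 _ w01.
  have Xvw := X_homo _ _ v01 w01 vw.
  have Fvw := cdf_homo vw.
  (* The part of the increment of [Phi] that involves [U] and the integral of [X * (1 - F)] both lie
     between [(w - v) * X v * (1 - F w)] and [(w - v) * X w * (1 - F v)]. The width of this range is
     controlled by writing the bracket as [X w * (F w - F v) + (X w - X v) * (1 - F w)]. *)
  have slack : (w - v) * (X w * (1 - F v) - X v * (1 - F w)) <=
      (w - v) * (X w + F w - (X v + F v)).
    rewrite ler_wpM2l ?subr_ge0//.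
    have := ler_piMl (_ : 0 <= F w - F v) Xw1.
    have := ler_piMr (_ : 0 <= X w - X v) Gw1.
    rewrite !subr_ge0 => /(_ Xvw) + /(_ Fvw); lra.
  have := ler_wpM2r Gw0 Ul; have := ler_wpM2r Gv0 Ur.
  rewrite ler_norml; move=> *; apply/andP; split; lra.
(* The boundary term [U * (1 - F)] vanishes at 0 by [U0] and at 1 because [F 1 = 1]. *)
rewrite /Phi set_itv1 !Rintegral_set1 U0 (density_cdf1 F_density) subrr mulr0.
by rewrite mul0r !addr0 subrr => /eqP; rewrite subr_eq0 => /eqP.
Qed.

End distributions.

(** * Single crossing of the inverse hazard rate with its mean *)

Section decreasing_inverse_hazard.
Context {R : realType} (F : cumulativeBounded (0 : R) (1 : R)) (f : R -> R).
Local Notation mu := (@lebesgue_measure R).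
Hypothesis F_density : has_density01 F f.
Hypothesis f_gt0 : {in `]0, 1[, forall v, 0 < f v}.
Hypothesis hazard_decr : {in `]0, 1[ &, forall v w,
  v <= w -> inverse_hazard F f w <= inverse_hazard F f v}.

Let m := \int[mu]_(v in `[0, 1]) (1 - F v).
(** On []0, 1[] this is the inverse hazard rate minus its mean, weighted by [f]. Written without the
    quotient, it is a difference of integrable functions. *)
Let d (v : R) := (1 - F v) - m * f v.

Lemma survival_gt0 (v : R) : v \in `]0, 1[ -> 0 < 1 - F v.
Proof.
rewrite in_itv/= => /andP[v0 v1].
rewrite -(survival_Rintegral F_density) ?(ltW v0) ?(ltW v1)//.
apply: Rintegral_itv_gt0 => //.
  exact: (integrable_itvS (ltW v0) _ (density_integrable F_density)).
by move=> x; rewrite in_itv/= => /andP[vx x1];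
  rewrite f_gt0// in_itv/= (lt_trans v0).
Qed.

Lemma integrable_survival :
  mu.-integrable `[0, 1] (EFin \o (fun v => 1 - F v)).
Proof.
apply: (@integrable_itv_bounded _ _ _ 1); first exact: survival_measurable.
by move=> v /(survival_itv F_density)/andP[? ?]; rewrite ger0_norm.
Qed.

Lemma mean_gt0 : 0 < m.
Proof.
apply: Rintegral_itv_gt0 => //; first exact: integrable_survival.
exact: survival_gt0.
Qed.

Lemma mean_le1 : m <= 1.
Proof.
suff : m <= 1 * (1 - 0) by rewrite mul1r subr0.
rewrite -Rintegral_itv_cst//; apply: Rintegral_itv_le.
- exact: integrable_survival.
- by apply: (@integrable_itv_bounded _ _ _ 1) => // x _; rewrite normr1.
- by move=> v /(survival_itv F_density)/andP[].
Qed.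

(** As [f > 0], the sign of [d] is that of the inverse hazard rate minus [m], which is
    nonincreasing: [d] can only pass from positive to negative. *)
Lemma deviation_sign (v w : R) : v \in `]0, 1[ -> w \in `]0, 1[ -> v <= w ->
  (0 < d w -> 0 < d v) /\ (d v < 0 -> d w < 0).
Proof.
move=> v01 w01 /(hazard_decr v01 w01); rewrite /inverse_hazard => h_le.
rewrite /d !subr_gt0 !subr_lt0 -!(ltr_pdivlMr _ _ (f_gt0 _))//.
rewrite -(ltr_pdivrMr _ _ (f_gt0 v01)) -(ltr_pdivrMr _ _ (f_gt0 w01)).
by split=> lt_m; [exact: lt_le_trans h_le|exact: le_lt_trans lt_m].
Qed.

Lemma integrable_deviation : mu.-integrable `[0, 1] (EFin \o d).
Proof.
apply: integrable_itvB; first exact: integrable_survival.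
exact: (integrable_itvZ _ (density_integrable F_density)).
Qed.

Lemma Rintegral_deviation : \int[mu]_(v in `[0, 1]) d v = 0.
Proof.
rewrite RintegralB//; first last.
- exact: (integrable_itvZ _ (density_integrable F_density)).
- exact: integrable_survival.
rewrite RintegralZl//; last exact: (density_integrable F_density).
rewrite (survival_Rintegral F_density) ?lexx ?ler01// (cdf0 F_density).
by rewrite subr0 mulr1 subrr.
Qed.

(* If [d >= 0] on (a, 1) with [a = 1 - m / 2], then [m * (1 - F a)] is at most the
   integral of [1 - F] over (a, 1), hence at most [m / 2 * (1 - F a)]. *)
Lemma deviation_lt0 : exists2 v, v \in `]0, 1[ & d v < 0.
Proof.
apply: contrapT => no_neg.
have d_ge0 v : v \in `]0, 1[ -> 0 <= d v.
  by move=> v01; rewrite leNgt; apply/negP => dv; apply: no_neg; exists v.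
have m0 := mean_gt0; have m1 := mean_le1.
pose a := 1 - m / 2.
have a0 : 0 < a by rewrite /a; lra.
have a1 : a < 1 by rewrite /a; lra.
have a01 : a \in `]0, 1[ by rewrite in_itv/= a0.
have iG := integrable_itvS (ltW a0) (lexx 1) integrable_survival.
have iF := integrable_itvS (ltW a0) (lexx 1) (density_integrable F_density).
have : 0 <= \int[mu]_(v in `[a, 1]) d v.
  apply: Rintegral_itv_ge0 => //.
    exact: integrable_itvS (ltW a0) (lexx 1) integrable_deviation.
  move=> x; rewrite in_itv/= => /andP[ax x1].
  by rewrite d_ge0// in_itv/= (lt_trans a0).
rewrite RintegralB//; last exact: integrable_itvZ.
rewrite RintegralZl// (survival_Rintegral F_density) ?(ltW a0) ?(ltW a1)//.
have : \int[mu]_(v in `[a, 1]) (1 - F v) <= (1 - F a) * (1 - a).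
  rewrite -Rintegral_itv_cst ?(ltW a1)//; apply: Rintegral_itv_le => //.
    exact: (@integrable_itv_bounded _ _ _ `|1 - F a|).
  by move=> x; rewrite in_itv/= => /andP[ax _]; rewrite lerB// cdf_homo.
have := mulr_gt0 m0 (survival_gt0 a01); rewrite /a; lra.
Qed.

(** If [d <= 0] throughout, its null integral would give it zeros in every subinterval, whereas [d]
    stays negative to the right of a point where it is negative. *)
Lemma deviation_gt0 : exists2 v, v \in `]0, 1[ & 0 < d v.
Proof.
apply: contrapT => no_pos.
have d_le0 v : v \in `]0, 1[ -> 0 <= -1 * d v.
  move=> v01; rewrite mulN1r oppr_ge0 leNgt; apply/negP => dv.
  by apply: no_pos; exists v.
have [w w01 dw] := deviation_lt0.
have := w01; rewrite in_itv/= => /andP[w0 w1].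
have [|||x x_in] := @Rintegral_itv_eq0 _ 0 1 w 1 _ _ d_le0 _ _ (lexx 1).
- exact: (integrable_itvZ _ integrable_deviation).
- by rewrite RintegralZl ?Rintegral_deviation ?mulr0//;
    exact: integrable_deviation.
- by rewrite (ltW w0).
move: x_in; rewrite in_itv/= => /andP[wx x1].
have x01 : x \in `]0, 1[ by rewrite in_itv/= (lt_trans w0).
have [_ /(_ dw) dx] := deviation_sign w01 x01 (ltW wx).
by move/eqP; rewrite mulN1r oppr_eq0 (lt_eqF dx).
Qed.

(** * Chebyshev's inequality and its equality case *)

Section chebyshev.
Variable X : R -> R.
Hypothesis mX : measurable_fun `[(0 : R), 1] X.
Hypothesis X01 : {in `[0, 1], forall v, 0 <= X v <= 1}.
Hypothesis X_homo : {in `[0, 1] &, forall v w, v <= w -> X v <= X w}.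

Let oo_cc (v : R) : v \in `]0, 1[ -> v \in `[0, 1].
Proof. by rewrite !in_itv/= => /andP[/ltW-> /ltW]. Qed.

(* The value separating [X] on [d > 0] from [X] on [d < 0]. *)
Let K := sup (X @` [set v | 0 < d v /\ v \in `]0, 1[]).

(** Points with [d > 0] lie to the left of points with [d < 0], so monotonicity of [X] gives
    [X <= K] on the former and [K <= X] on the latter. *)
Let K_sep (v : R) : v \in `]0, 1[ -> 0 <= (K - X v) * d v.
Proof.
move=> v01; have [dv|dv|->] := ltrgtP (d v) 0; last by rewrite mulr0.
- rewrite mulr_le0 ?(ltW dv)// subr_le0; apply: ge_sup.
    (* The set defining [K] is nonempty, so [K] is a genuine supremum and not a default value. *)
    by have [w w01 dw] := deviation_gt0; exists (X w), w.
  move=> _ [w /= [dw w01] <-]; apply: X_homo; rewrite ?oo_cc//.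
  rewrite leNgt; apply/negP => /ltW vw.
  have [_ /(_ dv)] := deviation_sign v01 w01 vw.
  by rewrite ltNge (ltW dw).
- rewrite mulr_ge0 ?(ltW dv)// subr_ge0; apply: ub_le_sup; last by exists v.
  by exists 1 => _ [w /= [_ /oo_cc/X01/andP[]] _ + <-].
Qed.

Let integrable_sep :
  mu.-integrable `[0, 1] (EFin \o (fun v => (K - X v) * d v)).
Proof.
apply: (@integrable_itvM_bounded _ _ _ (`|K| + 1)).
- by apply: measurable_funB.
- move=> v /X01/andP[X0 X1]; rewrite (le_trans (ler_normB _ _))// lerD2l.
  by rewrite ger0_norm.
- exact: integrable_deviation.
Qed.

(** The constant [K] drops out because [d] has integral 0; what remains is the gap in Chebyshev's
    inequality. *)
Let Rintegral_sep : \int[mu]_(v in `[0, 1]) ((K - X v) * d v) =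
  m * \int[mu]_(v in `[0, 1]) (X v * f v)
  - \int[mu]_(v in `[0, 1]) (X v * (1 - F v)).
Proof.
have iXf := integrable_mul_density F_density mX X01.
have iXG := integrable_mul_survival F_density mX X01.
rewrite -RintegralZl//.
have -> : \int[mu]_(v in `[0, 1]) ((K - X v) * d v) =
    \int[mu]_(v in `[0, 1]) (K * d v + (m * (X v * f v) - X v * (1 - F v))).
  by apply: eq_Rintegral => v _; rewrite /d; ring.
have imXf : mu.-integrable `[0, 1] (EFin \o (fun v => m * (X v * f v))).
  exact: integrable_itvZ.
rewrite RintegralD//; first last.
- exact: integrable_itvB.
- exact: (integrable_itvZ _ integrable_deviation).
rewrite RintegralB// [X in X + _]RintegralZl//;
  last exact: integrable_deviation.
by rewrite Rintegral_deviation mulr0 add0r.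
Qed.

Lemma chebyshev_survival :
  \int[mu]_(v in `[0, 1]) (X v * (1 - F v)) <=
  m * \int[mu]_(v in `[0, 1]) (X v * f v).
Proof. by rewrite -subr_ge0 -Rintegral_sep Rintegral_itv_ge0. Qed.

(** Equality makes the nonnegative [(K - X v) * d v] integrate to 0. It then has a zero near 0 where
    [d > 0] and another near 1 where [d < 0]; at both [X] equals [K], and monotonicity squeezes [X]
    in between. *)
Lemma chebyshev_survival_eq :
  \int[mu]_(v in `[0, 1]) (X v * (1 - F v)) =
  m * \int[mu]_(v in `[0, 1]) (X v * f v) ->
  exists k, {in `]0, 1[, forall v, X v = k}.
Proof.
move=> XGf; exists K.
have sep0 : \int[mu]_(v in `[0, 1]) ((K - X v) * d v) = 0.
  by rewrite Rintegral_sep XGf subrr.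
have X_K v : d v != 0 -> (K - X v) * d v = 0 -> X v = K.
  by move=> dv /eqP; rewrite mulf_eq0 (negPf dv) orbF subr_eq0 eq_sym => /eqP.
have [a a01 da] := deviation_gt0; have [b b01 db] := deviation_lt0.
have := a01; rewrite in_itv/= => /andP[a0 a1].
have := b01; rewrite in_itv/= => /andP[b0 b1].
move=> v v01; have := v01; rewrite in_itv/= => /andP[v0 v1].
(* A zero below [a] has [d > 0], and it is also kept below [v]; symmetrically, [y] is taken above
   both [b] and [v]. *)
have [||x x_in x0] := Rintegral_itv_eq0 integrable_sep K_sep sep0
  (c := 0) (d := Num.min a v).
- by rewrite lexx lt_min a0.
- by rewrite ge_min (ltW a1).
move: x_in; rewrite in_itv/= lt_min => /andP[x_gt0 /andP[xa xv]].
have x01 : x \in `]0, 1[ by rewrite in_itv/= x_gt0 (lt_trans xa).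
have [||y y_in y0] := Rintegral_itv_eq0 integrable_sep K_sep sep0
  (c := Num.max b v) (d := 1).
- by rewrite le_max (ltW b0) gt_max b1.
- by [].
move: y_in; rewrite in_itv/= gt_max => /andP[/andP[by_ vy] y1].
have y01 : y \in `]0, 1[ by rewrite in_itv/= y1 (lt_trans b0).
have dx : d x != 0.
  by rewrite gt_eqF//; apply: (deviation_sign x01 a01 (ltW xa)).1.
have dy : d y != 0.
  by rewrite lt_eqF//; apply: (deviation_sign b01 y01 (ltW by_)).2.
apply/eqP; rewrite eq_le -{1}(X_K _ dy y0) -(X_K _ dx x0).
by rewrite !X_homo ?oo_cc// ltW.
Qed.

End chebyshev.
End decreasing_inverse_hazard.

(** * Consequences of the mechanism constraints *)

Section mechanisms.
Context {R : realType} (F : cumulativeBounded (0 : R) (1 : R)) (f : R -> R).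
Local Notation mu := (@lebesgue_measure R).
Hypothesis F_density : has_density01 F f.
Variables (c rho : R) (X W p : R -> R).
Hypothesis c_gt0 : 0 < c.
Hypothesis XWp : mechanism c rho f X W p.

Lemma payoff_itv : {in `[0, 1], forall v, 0 <= payoff c X W v <= 1}.
Proof.
move=> v v01; rewrite (individual_rationality XWp)//= /payoff.
have /andP[X0 X1] := alloc_prob XWp v01.
have cW := mulr_ge0 (ltW c_gt0) (wait_ge0 XWp v01).
have : v * X v <= 1.
  by move: v01; rewrite in_itv/= => /andP[? ?]; rewrite mulr_ile1.
lra.
Qed.

Lemma payoff0 : payoff c X W 0 = 0.
Proof.
have zero01 : 0 \in `[(0 : R), 1] by rewrite in_itv/= lexx ler01.
apply/eqP; rewrite eq_le (individual_rationality XWp)// andbT.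
by rewrite /payoff mul0r sub0r oppr_le0 mulr_ge0 ?(ltW c_gt0) ?(wait_ge0 XWp).
Qed.

Lemma payoff_envelope : {in `[0, 1] &, forall v w, v <= w ->
  (w - v) * X v <= payoff c X W w - payoff c X W v <= (w - v) * X w}.
Proof.
move=> v w v01 w01 _; have := incentive_compatibility XWp v01 w01.
have := incentive_compatibility XWp w01 v01.
rewrite /payoff => *; apply/andP; split; lra.
Qed.

Lemma alloc_homo : {in `[0, 1] &, forall v w, v <= w -> X v <= X w}.
Proof.
move=> v w v01 w01; rewrite le_eqVlt => /predU1P[->//|vw].
have /andP[l r] := payoff_envelope v01 w01 (ltW vw).
by rewrite -(@ler_pM2l _ (w - v)) ?subr_gt0// (le_trans l).
Qed.

Lemma payoff_measurable : measurable_fun `[(0 : R), 1] (payoff c X W).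
Proof.
apply: measurable_funB; apply: measurable_funM => //.
  exact: (alloc_measurable XWp).
exact: (wait_measurable XWp).
Qed.

Lemma integrable_alloc :
  mu.-integrable `[0, 1] (EFin \o (fun v => X v * f v)).
Proof.
exact: (integrable_mul_density F_density (alloc_measurable XWp)
  (alloc_prob XWp)).
Qed.

Lemma integrable_payoff :
  mu.-integrable `[0, 1] (EFin \o (fun v => payoff c X W v * f v)).
Proof.
exact: (integrable_mul_density F_density payoff_measurable payoff_itv).
Qed.

Lemma feasibility_Rintegral :
  rho * \int[mu]_(v in `[0, 1]) (X v * f v) <= 1.
Proof.
have := feasibility XWp.
by rewrite -(fineK (integrable_fin_num _ integrable_alloc))// -EFinM lee_fin.
Qed.

Lemma objectiveE (profit alpha : R) : objective c profit alpha rho f X W =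
  (alpha * rho * \int[mu]_(v in `[0, 1]) (payoff c X W v * f v)
   + (1 - alpha) * rho * (profit * \int[mu]_(v in `[0, 1]) (X v * f v)))%:E.
Proof.
rewrite -(RintegralZl profit)//; last exact: integrable_alloc.
rewrite /objective -(fineK (integrable_fin_num _ integrable_payoff))//.
rewrite EFinD !EFinM; congr (_ + _ * _)%E.
under eq_integral do rewrite -mulrA.
have ipX := integrable_itvZ profit integrable_alloc.
by rewrite -(fineK (integrable_fin_num _ ipX)).
Qed.

Lemma welfare_survival :
  \int[mu]_(v in `[0, 1]) (payoff c X W v * f v) =
  \int[mu]_(v in `[0, 1]) (X v * (1 - F v)).
Proof.
apply: (integral_envelope F_density (alloc_measurable XWp) payoff_measurable).
- exact: (alloc_prob XWp).
- exact: payoff_itv.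
- exact: alloc_homo.
- exact: payoff_envelope.
- exact: payoff0.
Qed.

(** With equal allocations, incentive compatibility equalizes the waits, and a buyer of value near 0
    cannot afford a positive one. Value 1 is left out: there [X 1 > k] with the wait [(X 1 - k) / c]
    is compatible with the incentives. *)
Lemma wait_eq0 (k : R) : {in `]0, 1[, forall v, X v = k} ->
  {in `[0, 1[, forall v, W v = 0}.
Proof.
move=> Xk.
have oo_cc (v : R) : v \in `]0, 1[ -> v \in `[0, 1].
  by rewrite !in_itv/= => /andP[/ltW-> /ltW].
have W_cst v w : v \in `]0, 1[ -> w \in `]0, 1[ -> W v <= W w.
  move=> v01 w01.
  have := incentive_compatibility XWp (oo_cc _ v01) (oo_cc _ w01).
  by rewrite /payoff !Xk// lerD2l lerN2 ler_pM2l.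
have W_le0 v : v \in `]0, 1[ -> W v <= 0.
  move=> v01; rewrite leNgt; apply/negP => Wv.
  have cWv := mulr_gt0 c_gt0 Wv.
  (* A buyer of value [w] gains at most [w], half the common waiting cost, contradicting individual
     rationality; the bound [1 / 2] keeps [w] below 1. *)
  pose w := Num.min (c * W v / 2) (1 / 2).
  have w01 : w \in `]0, 1[.
    rewrite in_itv/= lt_min gt_min; apply/andP; split.
      by apply/andP; split; lra.
    by apply/orP; right; lra.
  have := individual_rationality XWp (oo_cc _ w01).
  rewrite /payoff Xk//.
  have /andP[k0 k1] := alloc_prob XWp (oo_cc _ w01); rewrite Xk// in k0 k1.
  have : c * W v <= c * W w by rewrite ler_pM2l// W_cst.
  have : w * k <= w.
    by rewrite ler_piMr//; move: w01; rewrite in_itv => /andP[/ltW].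
  have : w <= c * W v / 2 by rewrite ge_min lexx.
  lra.
move=> v; rewrite in_itv/= le_eqVlt => /andP[/predU1P[<- _|v0 v1]].
  have := payoff0; rewrite /payoff mul0r sub0r => /eqP.
  by rewrite oppr_eq0 mulf_eq0 gt_eqF//= => /eqP.
have v01 : v \in `]0, 1[ by rewrite in_itv/= v0.
by apply/eqP; rewrite eq_le W_le0// (wait_ge0 XWp)// oo_cc.
Qed.

Lemma queue_eq0 : {in `[0, 1[, forall v, W v = 0} ->
  {in `[0, 1], forall v, p v = 0}.
Proof.
move=> W0 v v01; apply: EFin_inj; rewrite -(little_law XWp v01).
move: v01; rewrite in_itv/= => /andP[v0 _].
(* The point 1, where [W] may be nonzero, is null and is removed from the domain. *)
rewrite -integral_itv_bndo_bndc.
  rewrite integral0_eq ?mule0// => x /=; rewrite in_itv/= => /andP[vx x1].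
  by rewrite W0 ?mul0r// in_itv/= x1 (le_trans v0).
apply/measurable_EFinP; apply: measurable_funM.
  apply: measurable_funS (wait_measurable XWp) => // x /=.
  by rewrite !in_itv/= => /andP[/(le_trans v0)-> /ltW].
apply: measurable_funS (density_measurable F_density) => // x /=.
by rewrite !in_itv/= => /andP[/(le_trans v0)-> /ltW].
Qed.

End mechanisms.

(** * Optimality and uniqueness of the lottery *)

Lemma lottery_mechanism (R : realType) (c rho : R)
    (F : cumulativeBounded (0 : R) (1 : R)) (f : R -> R) :
  0 < c -> 1 < rho -> has_density01 F f ->
  mechanism c rho f (fun=> 1 / rho) (fun=> 0) (fun=> 0).
Proof.
move=> c_gt0 rho_gt1 F_density.
have rho_gt0 : 0 < rho by rewrite (lt_trans ltr01).
have irho : 0 <= 1 / rho <= 1.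
  by rewrite divr_ge0 ?ler01 ?(ltW rho_gt0)//= ler_pdivrMr// mul1r ltW.
split => //.
- move=> v; rewrite in_itv/= => /andP[v0 _]; rewrite /payoff mulr0 subr0.
  by rewrite mulr_ge0//; case/andP: irho.
- move=> v v01; under eq_integral do rewrite mul0r.
  by rewrite integral0 mule0.
- have irf := integrable_itvZ (1 / rho) (density_integrable F_density).
  rewrite -(fineK (integrable_fin_num _ irf))// -EFinM lee_fin.
  rewrite -[fine _]/(Rintegral _ _ _) RintegralZl//;
    last exact: (density_integrable F_density).
  rewrite (survival_Rintegral F_density) ?lexx ?ler01// (cdf0 F_density).
  by rewrite subr0 mulr1 mulrC divfK// gt_eqF.
Qed.

(** Uniqueness is stated for [0 < alpha]: when only profit counts, a posted waiting time that serves
    exactly the highest values, in total mass 1, is optimal as well. It is stated away from the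
    endpoints for [X], and from 1 for [W], since changes at these null points can leave the
    objective and the constraints intact. *)
Theorem theorem8 (R : realType) (c profit alpha rho : R)
    (F : cumulativeBounded (0 : R) (1 : R)) (f : R -> R)
    (c_gt0 : 0 < c) (profit_gt0 : 0 < profit) (alpha01 : 0 <= alpha <= 1)
    (rho_gt1 : 1 < rho)
    (F_density : has_density01 F f)
    (f_gt0 : {in `]0, 1[, forall v, 0 < f v})
    (hazard_decr : {in `]0, 1[ &, forall v w,
      v <= w -> inverse_hazard F f w <= inverse_hazard F f v}) :
  optimal_mechanism c profit alpha rho f
    (fun=> 1 / rho) (fun=> 0) (fun=> 0)
  /\
  (0 < alpha -> forall X W p : R -> R,
    optimal_mechanism c profit alpha rho f X W p ->
    [/\ {in `]0, 1[, forall v, X v = 1 / rho},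
        {in `[0, 1[, forall v, W v = 0} &
        {in `[0, 1], forall v, p v = 0}]).
Proof.
have rho_gt0 : 0 < rho by rewrite (lt_trans ltr01).
have lot := lottery_mechanism c_gt0 rho_gt1 F_density.
pose m := \int[@lebesgue_measure R]_(v in `[0, 1]) (1 - F v).
have m_gt0 : 0 < m := mean_gt0 F_density f_gt0.
have alloc_cst k : \int[@lebesgue_measure R]_(v in `[0, 1]) (k * f v) = k.
  rewrite RintegralZl//; last exact: (density_integrable F_density).
  rewrite (survival_Rintegral F_density) ?lexx ?ler01// (cdf0 F_density).
  by rewrite subr0 mulr1.
have lot_obj : objective c profit alpha rho f (fun=> 1 / rho) (fun=> 0) =
    (alpha * m + (1 - alpha) * profit)%:E.
  rewrite (objectiveE F_density c_gt0 lot) (welfare_survival F_density c_gt0 lot).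
  rewrite alloc_cst RintegralZl//; last exact: (integrable_survival F_density).
  by congr EFin; rewrite -/m; field; rewrite gt_eqF.
have bound X W p : mechanism c rho f X W p ->
    let A := \int[@lebesgue_measure R]_(v in `[0, 1]) (payoff c X W v * f v) in
    let B := \int[@lebesgue_measure R]_(v in `[0, 1]) (X v * f v) in
    rho * A <= m * (rho * B) /\ rho * B <= 1.
  move=> XWp A B; split; last exact: (feasibility_Rintegral F_density XWp).
  rewrite mulrCA ler_pM2l// /A (welfare_survival F_density c_gt0 XWp).
  apply: (chebyshev_survival F_density f_gt0 hazard_decr).
  - exact: (alloc_measurable XWp).
  - exact: (alloc_prob XWp).
  - exact: (alloc_homo XWp).
have /andP[alpha_ge0 alpha_le1] := alpha01.
have profit_bound B : rho * B <= 1 ->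
    (1 - alpha) * rho * (profit * B) <= (1 - alpha) * profit.
  move=> rB; have : 0 <= (1 - alpha) * profit.
    by rewrite mulr_ge0 ?subr_ge0// ltW.
  by move=> /ler_wpM2l/(_ _ _ rB); lra.
split.
  split=> // X W p XWp; rewrite lot_obj (objectiveE F_density c_gt0 XWp).
  rewrite lee_fin; have [] := bound _ _ _ XWp.
  set A := Rintegral _ _ _; set B := Rintegral _ _ _.
  move=> AB rB; apply: lerD; last exact: profit_bound.
  rewrite -mulrA ler_wpM2l// (le_trans AB)//.
  by rewrite -[leRHS]mulr1 ler_wpM2l// ltW.
move=> alpha_gt0 X W p [XWp opt]; have := opt _ _ _ lot.
rewrite lot_obj (objectiveE F_density c_gt0 XWp) lee_fin.
have [] := bound _ _ _ XWp.
set A := Rintegral _ _ _; set B := Rintegral _ _ _ => AB rB obj.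
(* The profit term cannot exceed that of the lottery, so matching the objective of the lottery
   forces the welfare term to do so; dividing by [alpha] uses [alpha_gt0]. *)
have rA : m <= rho * A.
  have := profit_bound _ rB => pB; rewrite -(ler_pM2l alpha_gt0); lra.
(* From [m <= rho * A <= m * (rho * B)], feasibility must bind. *)
have rB1 : rho * B = 1.
  apply/eqP; rewrite eq_le rB -(ler_pM2l m_gt0) mulr1.
  exact: (le_trans rA AB).
have AmB : A = m * B.
  apply/eqP; rewrite -(inj_eq (mulfI (lt0r_neq0 rho_gt0))) mulrCA eq_le AB.
  by rewrite rB1 mulr1.
have [k Xk] : exists k, {in `]0, 1[, forall v, X v = k}.
  apply: (chebyshev_survival_eq F_density f_gt0 hazard_decr
    (alloc_measurable XWp) (alloc_prob XWp) (alloc_homo XWp)).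
  by rewrite -(welfare_survival F_density c_gt0 XWp).
have W0 := wait_eq0 c_gt0 XWp Xk.
split=> //; last exact: (queue_eq0 F_density XWp W0).
(* The constant [k] is the integral of [k * f], hence [B], and [rB1] fixes its value. *)
move=> v v01; rewrite (Xk _ v01); apply: (mulfI (lt0r_neq0 rho_gt0)).
rewrite mulrCA divff ?gt_eqF// mulr1 -rB1; congr (_ * _).
rewrite -[k]alloc_cst; apply: eq_Rintegral_itv_oo => //.
- exact: (integrable_itvZ _ (density_integrable F_density)).
- exact: (integrable_alloc F_density XWp).
- by move=> x /Xk ->.
Qed.
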